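(* There exist universal constants $c, C > 0$ such that the following holds. Let $M \ge 1$ be an integer, and let $G$ be a connected $n$-vertex, $d$-regular $\lambda$-expander ($d \ge 2$, $\lambda>0$) with $\lambda \le d/5 \le cn$ and $$M \le \min\left\{ c\,\frac{d^{3/2}}{\lambda \log d},\ (\log n)^C \right\}.$$ Fix $k \in \mathbb{Z}$, and let $f$ be chosen uniformly at random from the (finite) set $\mathrm{Lip}^*_k(G;M)$. Then for every integer $t \ge 2$ and every $v \in V(G)$, $$\mathbb{P}\left( f(v) > k + tM + 1 \right) \le 2^{-|B(v,t-1)|/(5M)} .$$
   Context: All graphs are finite and simple; $\log$ denotes $\log_2$. For a real number $\lambda$, an $n$-vertex $d$-regular graph $G$ is called a $\lambda$-expander if for all $S, T \subseteq V(G)$, $$\left| e(S,T) - \frac{d}{n}|S||T| \right| \le \lambda \sqrt{|S||T|},$$ where $e(S,T)$ is the number of edges with one endpoint in $S$ and the other in $T$, counted twice if both endpoints lie in $S \cap T$ (i.e. the number of ordered pairs $(s,t) \in S \times T$ with $\{s,t\} \in E(G)$). $\mathrm{Lip}(G;M)$ is the set of all $f : V(G) \to \mathbb{Z}$ with $|f(u)-f(v)| \le M$ for every $\{u,v\} \in E(G)$. For an $n$-vertex $d$-regular $\lambda$-expander $G$ and $k\in\mathbb{Z}$, $$\mathrm{Lip}^*_k(G;M) = \left\{ f \in \mathrm{Lip}(G;M) : \left|\{ v \in V(G) : f(v) \notin \{k,k+1,\dots,k+M\} \}\right| \le \frac{2\lambda}{d} n \right\}.$$ For $v \in V(G)$ and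 an integer $t \ge 0$, $B(v,t) = \{u \in V(G) : \mathrm{dist}_G(u,v) \le t\}$. *)

(* Defs.v *)
From mathcomp Require Import all_boot all_order all_algebra finmap.
From mathcomp Require Import boolp classical_sets functions cardinality.
From mathcomp Require Import reals exp.

Set Implicit Arguments.
Unset Strict Implicit.
Unset Printing Implicit Defensive.

Import Order.TTheory GRing.Theory Num.Theory.

Local Open Scope ring_scope.

Section Graphs.
Variables (V : finType) (e : rel V).

Definition simple_graph : Prop := symmetric e /\ irreflexive e.

Definition connected_graph : Prop := forall u v : V, connect e u v.

Definition regular (d : nat) : Prop := forall v : V, #|[set u | e v u]| = d.

Definition edge_count (S T : {set V}) : nat :=
  #|[set p : V * V | [&& p.1 \in S, p.2 \in T & e p.1 p.2]]|.

Definition walk (m : nat) (u v : V) : bool :=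
  [exists p : m.-tuple V, path e u p && (last u p == v)].

(* A shortest walk has fewer than #|V| edges, so the search succeeds whenever
   v is reachable from u (see distP); otherwise dist u v = #|V|. *)
Definition dist (u v : V) : nat := find (fun m => walk m u v) (iota 0 #|V|).

Definition gball (v : V) (t : nat) : {set V} :=
  [set u | (dist u v <= t)%N].

Definition Lip (M : nat) (f : {ffun V -> int}) : Prop :=
  forall u v : V, e u v -> `|f u - f v| <= M%:Z.

Definition outliers (M : nat) (k : int) (f : {ffun V -> int}) : {set V} :=
  [set v | ~~ (k <= f v <= k + M%:Z)].

Variable R : realType.

Definition expander (d : nat) (lambda : R) : Prop :=
  regular d /\
  forall S T : {set V},
    `|(edge_count S T)%:R - d%:R / #|V|%:R * #|S|%:R * #|T|%:R|
      <= lambda * Num.sqrt (#|S|%:R * #|T|%:R).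

Definition Lip_star (d : nat) (lambda : R) (M : nat) (k : int) :
    set {ffun V -> int} :=
  [set f | Lip M f /\
    #|outliers M k f|%:R
      <= 2 * lambda / d%:R * #|V|%:R]%classic.

End Graphs.

Definition log2 (R : realType) (x : R) : R := ln x / ln 2.

(* The probability that a uniformly random element of A lies in E. It is only
   meaningful for A finite and nonempty (fset_set of an infinite set is empty);
   see finite_Lip_star and Lip_star_neq0. *)
Definition uniform_prob (R : realType) (X : choiceType) (A E : set X) : R :=
  #|` fset_set (A `&` E)%classic|%:R / #|` fset_set A|%:R.

Section Facts.
Variables (V : finType) (e : rel V).

Lemma walkP (m : nat) (u v : V) :
  reflect (exists p, [/\ size p = m, path e u p & last u p = v])
          (walk e m u v).
Proof.
apply: (iffP existsP) => [[p /andP[up /eqP lp]]|[p [sp up lp]]].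
  by exists p; rewrite size_tuple.
have /eqP sp' := sp.
by exists (Tuple sp'); rewrite /= up lp eqxx.
Qed.

Lemma distP (u v : V) : connect e u v ->
  walk e (dist e u v) u v /\
  forall m, walk e m u v -> (dist e u v <= m)%N.
Proof.
move=> /connectP[p up ->]; case/shortenP: up => p' up' Up' _.
set w := last u p'.
have szp : (size p' < #|V|)%N.
  by have := max_card (mem (u :: p')); rewrite (card_uniqP Up').
have hasw : has (fun m => walk e m u w) (iota 0 #|V|).
  apply/hasP; exists (size p'); first by rewrite mem_iota.
  by apply/walkP; exists p'.
have ltd : (dist e u w < #|V|)%N.
  by rewrite /dist -[X in (_ < X)%N](size_iota 0) -has_find.
split.
  by have := nth_find 0%N hasw; rewrite -/(dist e u w) nth_iota.
move=> m wm; rewrite leqNgt; apply/negP => ltm.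
have := before_find 0%N ltm.
by rewrite nth_iota ?(ltn_trans ltm) // add0n wm.
Qed.

Variable R : realType.

Lemma finite_Lip_star (d : nat) (lambda : R) (M : nat) (k : int) :
  connected_graph e -> (0 < #|V|)%N -> (0 < d)%N -> lambda <= d%:R / 5 ->
  finite_set (Lip_star e d lambda M k).
Proof.
move=> conn V0 d0 ld.
pose B := (M + #|V| * M)%N.
pose g (h : {ffun V -> 'I_(B + B).+1}) : {ffun V -> int} :=
  [ffun v => (h v : nat)%:Z - B%:Z + k].
apply: (@sub_finite_set _ _ (g @` [set: {ffun V -> 'I_(B + B).+1}])%classic);
  last by apply: finite_image; exact: finite_finset.
move=> f [Lf bad].
have [v0 v0P] : exists v, k <= f v <= k + M%:Z.
  apply: contrapT => nov.
  have badT : outliers M k f = [set: V].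
    by apply/setP => v; rewrite !inE; apply/negP => fv; apply: nov; exists v.
  move: bad; rewrite badT cardsT.
  have n0 : 0 < #|V|%:R :> R by rewrite ltr0n.
  rewrite -{1}[#|V|%:R]mul1r (ler_pM2r n0) ler_pdivlMr ?ltr0n // mul1r.
  have d0' : 0 < d%:R :> R by rewrite ltr0n.
  apply/negP; rewrite -ltNge.
  apply: (@le_lt_trans _ _ (2 * (d%:R / 5))); first by rewrite ler_pM2l.
  by rewrite mulrCA gtr_pMr // ltr_pdivrMr // mul1r ltr_nat.
have lipw p u : path e u p -> `|f u - f (last u p)| <= (size p * M)%:Z.
  elim: p u => [|w p IH] u /=; first by rewrite subrr normr0.
  move=> /andP[uw wp]; rewrite mulSn PoszD.
  rewrite -(subrKA (f w)); apply: le_trans (ler_normD _ _) _.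
  by apply: lerD; [exact: Lf | exact: IH].
have bnd v : `|f v - k| <= B%:Z.
  have /connectP[p up ev] := conn v v0.
  case/shortenP: up ev => p' up' Up' _ ev.
  have szp : (size p' < #|V|)%N.
    by have := max_card (mem (v :: p')); rewrite (card_uniqP Up').
  rewrite -(subrKA (f v0)) /B addnC PoszD.
  apply: le_trans (ler_normD _ _) (lerD _ _).
    rewrite ev; apply: le_trans (lipw _ _ up') _.
    by rewrite lez_nat leq_mul2r (ltnW szp) orbT.
  case/andP: v0P => kf fk.
  by rewrite ger0_norm ?subr_ge0 // lerBlDl.
have ge0 v : 0 <= f v - k + B%:Z.
  by have := bnd v; rewrite ler_norml => /andP[? _]; rewrite -lerBlDr sub0r.
exists [ffun v => inord (absz (f v - k + B%:Z))] => //.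
apply/ffunP => v; rewrite !ffunE inordK; first by rewrite gez0_abs // addrK subrK.
rewrite ltnS -lez_nat gez0_abs // PoszD lerD2r.
by have := bnd v; rewrite ler_norml => /andP[].
Qed.

Lemma Lip_star_neq0 (d : nat) (lambda : R) (M : nat) (k : int) :
  0 <= lambda -> (Lip_star e d lambda M k !=set0)%classic.
Proof.
move=> l0; exists [ffun=> k]; split.
  by move=> u v _; rewrite !ffunE subrr normr0.
rewrite (_ : outliers M k _ = finset.set0) ?cards0; last first.
  by apply/setP => v; rewrite !inE ffunE lexx lerDl.
by rewrite !mulr_ge0 ?invr_ge0.
Qed.

End Facts.

(* Main.v *)
(* Put h = f - k - M and suppose h(v) > (t-1)M + 1. Let A be the component of v
   in {h > M} for the relation "at distance at most 3"; it contains
   X = B(v, t-2). For each level i, the set A_i = {u in A : h(u) > M + i} is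
   encoded by a small set Y_i: chosen greedily, from the top level down, so that
   each new element covers at least d/10 new vertices, Y_i yields a set F_i (the
   closed neighbourhood of Y_i, enlarged by that of X when i = 0) such that
   every vertex of A_i has at least 9d/10 neighbours in F_i. Hence A_i lies in
   the core S_i of F_i, and since F_i consists of outliers, so that
   |F_i| <= 2 lambda n / d, expansion gives |S_i| <= |F_i| / 6.

   On F_i we have h > i, and on S_0 and F_0 the number of levels i with u in S_i
   bounds h(u) - M. So, with everything else frozen, f(u) ranges over an interval
   of length M + 1 + #{i : u in S_i} - #{i : u in F_i}, whereas all M + 1 values
   of h(u) in [0, M] would be allowed (for u in S_0 outside F_0, lengths
   M + #{i : u in S_i} and M, with h(u) in [1, M], so that no new outlier
   appears). Multiplying over u, the functions with given sets Y_i make up a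
   proportion at most exp(sum_i |S_i| / M - |F_i| / (M + 1)) of Lip*, which is
   at most exp(- sum_i |F_i| / (3M)).

   The sets Y_i are nested, so they form a labelling whose support is connected
   to X by steps of length at most 7; the sum over such labellings converges
   because |F_i| >= d |Y_i| / 10 and M log d <= c d. The latter follows from the
   hypothesis on M, as every d-regular expander has lambda >= sqrt d / 2. *)

Require Import Defs.
From mathcomp Require Import all_boot all_order all_algebra finmap.
From mathcomp Require Import boolp classical_sets functions cardinality.
From mathcomp Require Import reals sequences exp.
From mathcomp Require Import zify ring lra.
Import fintype boot.finset.

Set Implicit Arguments.
Unset Strict Implicit.
Unset Printing Implicit Defensive.

Import Order.TTheory GRing.Theory Num.Theory.
Local Open Scope ring_scope.

(** * Closed neighbourhoods and bounded distance *)

Section ClosedNeighbourhood.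
Variables (V : finType) (e : rel V).

Definition cnbhd (X : {set V}) : {set V} :=
  \bigcup_(x in X) (x |: [set u | e x u]).

(** Distance at most [m], encoded by iterated closed neighbourhoods: induction on [m] and the degree
    bound then need no walks. *)
Definition near (m : nat) (x y : V) : bool := y \in iter m cnbhd [set x].

Lemma cnbhdP (X : {set V}) (u : V) :
  reflect (exists2 x, x \in X & (u == x) || e x u) (u \in cnbhd X).
Proof.
apply: (iffP bigcupP) => [[x xX]|[x xX xu]]; first by rewrite !inE; exists x.
by exists x; rewrite // !inE.
Qed.

Lemma sub_cnbhd (X : {set V}) : X \subset cnbhd X.
Proof. by apply/subsetP => x xX; apply/cnbhdP; exists x; rewrite ?eqxx. Qed.

Lemma cnbhdS (X Y : {set V}) : X \subset Y -> cnbhd X \subset cnbhd Y.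
Proof.
move=> /subsetP XY; apply/subsetP => u /cnbhdP[x xX xu].
by apply/cnbhdP; exists x; first exact: XY.
Qed.

Lemma card_cnbhd (d : nat) (X : {set V}) :
  regular e d -> (#|cnbhd X| <= #|X| * d.+1)%N.
Proof.
move=> reg; rewrite -sum_nat_const.
rewrite /cnbhd; elim/big_rec2: _ => [|x n Y _ IH]; first by rewrite cards0.
apply: leq_trans (leq_card_setU _ _) _; rewrite leq_add //.
by rewrite cardsU1 reg; case: (_ \notin _).
Qed.

Lemma near0 x : near 0 x x.
Proof. exact: set11. Qed.

Lemma nearS m x y z : near m x y -> (z == y) || e y z -> near m.+1 x z.
Proof. by move=> xy yz; apply/cnbhdP; exists y. Qed.

Lemma nearSP m x z :
  near m.+1 x z -> exists2 y, near m x y & (z == y) || e y z.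
Proof. by move/cnbhdP. Qed.

Lemma near1 x y : e x y -> near 1 x y.
Proof. by move=> xy; apply: (nearS (near0 x)); rewrite xy orbT. Qed.

Lemma near_trans m n x y z : near m x y -> near n y z -> near (m + n) x z.
Proof.
move=> xy; elim: n z => [|n IH] z; first by rewrite addn0 => /set1P->.
by move=> /nearSP[w yw wz]; rewrite addnS; apply: nearS wz; apply: IH.
Qed.

Lemma near_leq m n x y : (m <= n)%N -> near m x y -> near n x y.
Proof.
move=> /subnKC <- xy; apply: near_trans xy _.
by elim: (n - m)%N => [|k IH]; [exact: near0 | apply: nearS IH _; rewrite eqxx].
Qed.

Lemma near_sym m x y : symmetric e -> near m x y -> near m y x.
Proof.
move=> sym; elim: m y => [|m IH] y; first by move=> /set1P->; exact: near0.
move=> /nearSP[w xw wy]; rewrite -add1n; apply: near_trans (IH _ xw).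
by apply: nearS (near0 _) _; rewrite eq_sym sym.
Qed.

Lemma card_near (d m : nat) (x : V) :
  regular e d -> (#|[set y | near m x y]| <= d.+1 ^ m)%N.
Proof.
move=> reg; rewrite (_ : [set y | _] = iter m cnbhd [set x]); last first.
  by apply/setP => y; rewrite inE.
elim: m => [|m IH]; first by rewrite cards1.
by apply: leq_trans (card_cnbhd _ reg) _; rewrite expnSr leq_mul2r IH orbT.
Qed.

Lemma near_Lipschitz (h : V -> int) (M m : nat) (x y : V) :
  (forall u w, e u w -> `|h u - h w| <= M%:Z) ->
  near m x y -> `|h x - h y| <= (m * M)%:Z.
Proof.
move=> Lh; elim: m y => [|m IH] y; first by move=> /set1P->; rewrite subrr.
move=> /nearSP[w xw /orP[/eqP->|wy]].
  by apply: le_trans (IH _ xw) _; rewrite lez_nat leq_mul2r leqnSn orbT.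
rewrite -(subrKA (h w)) mulSnr PoszD; apply: le_trans (ler_normD _ _) _.
by apply: lerD; [exact: IH | exact: Lh].
Qed.

Lemma gball_near (v u : V) (t : nat) :
  symmetric e -> connected_graph e -> u \in gball e v t -> near t v u.
Proof.
move=> sym conn; rewrite inE => /near_leq; apply; apply: near_sym => //.
have [/walkP[p [<- up <-]] _] := distP (conn u v).
elim: p u up => [|w p IH] u /=; first by rewrite near0.
by case/andP=> uw wp; rewrite -add1n; apply: near_trans (near1 uw) (IH _ wp).
Qed.

End ClosedNeighbourhood.

(** * Weighted sums over sets connected to a given set *)

Section Attached.
Variables (V : finType) (H : rel V).

(** A cut form of connectivity: every vertex of [Y] ends an [H]-path of at least one step that
    starts in [X] and then stays in [Y]. *)
Definition attached (X Y : {set V}) : bool :=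
  [forall T : {set V}, (T \proper Y) ==>
    [exists x in X :|: T, exists y in Y :\: T, H x y]].

Lemma attachedP (X Y : {set V}) :
  reflect (forall T : {set V}, T \proper Y ->
             exists x y, [/\ x \in X :|: T, y \in Y :\: T & H x y])
          (attached X Y).
Proof.
apply: (iffP forallP) => [att T TY|att T]; last first.
  apply/implyP => /att[x [y [xX yY xy]]].
  by apply/existsP; exists x; rewrite xX; apply/existsP; exists y; rewrite yY.
have /existsP[x /andP[xX /existsP[y /andP[yY xy]]]] := implyP (att T) TY.
by exists x, y.
Qed.

(** A cut [T] of the remaining set is tested through [u |: T], so a revealed vertex may join the
    roots [X]. *)
Lemma attachedD1 (X Y : {set V}) (u : V) :
  u \in Y -> attached X Y -> attached (u |: X) (Y :\ u).
Proof.
move=> uY /attachedP att; apply/attachedP => T /properP[TY [z zY zT]].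
move: zY; rewrite !inE => /andP[zu zY].
have uT : u \notin T by apply/negP => /(subsetP TY); rewrite !inE eqxx.
have [|x [y [xX yY xy]]] := att (u |: T).
  apply/properP; split; last by exists z; rewrite // !inE negb_or zu.
  by rewrite subUset sub1set uY (subset_trans TY) ?subD1set.
exists x, y; split=> //.
  by move: xX; rewrite !inE => /or3P[->|->|->]; rewrite ?orbT.
move: yY; rewrite !inE negb_or => /andP[/andP[yu yT] yY].
by rewrite yT yu yY.
Qed.

Variable R : realFieldType.

Definition edges_into (X U : {set V}) : nat :=
  (\sum_(x in X) #|[set y in U | H x y]|)%N.

(* Reveal whether a vertex adjacent to [X] belongs to [Y]: either way at least
   one edge from [X] is used up, and if it does belong at most [D] new edges
   appear. *)
Lemma sum_attached (q : R) (D : nat) (X U : {set V}) :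
  0 <= q -> (forall x, (#|[set y | H x y]| <= D)%N) -> (1 + 2 * q) ^+ D <= 2 ->
  \sum_(Y : {set V} | (Y \subset U) && attached X Y) q ^+ #|Y|
    <= (1 + 2 * q) ^+ edges_into X U.
Proof.
move=> q0 degH bD; set b := 1 + 2 * q in bD *.
have b1 : 1 <= b by rewrite /b lerDl mulr_ge0.
have [n] := ubnP #|U|; elim: n X U => // n IH X U; rewrite ltnS => Un.
have [/existsP[u /andP[uU /existsP[x0 /andP[x0X x0u]]]]|noU] :=
    boolP [exists u in U, exists x in X, H x u]; last first.
  (* No vertex of [U] is adjacent to [X], so the empty set is the only attached one. *)
  apply: (@le_trans _ _ 1); last exact: exprn_ege1.
  rewrite (big_pred1 set0) ?cards0 // => Y /=.
  apply/andP/eqP => [[YU /attachedP att]|->]; last first.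
    split; first exact: sub0set.
    by apply/attachedP => T; rewrite /proper subset0 => /andP[/eqP->]; rewrite sub0set.
  apply/eqP/negPn/negP => Y0.
  have [|x [y [xX yY xy]]] := att set0; first by rewrite proper0.
  move/existsP: noU; apply; exists y.
  move: yY xX; rewrite setD0 setU0 => yY xX.
  by rewrite (subsetP YU) //; apply/existsP; exists x; rewrite xX.
rewrite (bigID (fun Y : {set V} => u \in Y)) /=.
have Uu : (#|U :\ u| < n)%N by move: Un; rewrite (cardsD1 u) uU.
have edgeU : (edges_into X (U :\ u) < edges_into X U)%N.
  rewrite /edges_into (bigD1 x0) //= [X in (_ < X)%N](bigD1 x0) //=.
  rewrite -addSn leq_add //; last first.
    by apply: leq_sum => x _; apply/subset_leq_card/subsetP => y; rewrite !inE => /andP[/andP[_ ->] ->].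
  apply: proper_card; apply/properP; split.
    by apply/subsetP => y; rewrite !inE => /andP[/andP[_ ->] ->].
  by exists u; rewrite !inE ?uU ?eqxx.
have edgeuX : (edges_into (u |: X) (U :\ u) <= edges_into X (U :\ u) + D)%N.
  rewrite /edges_into (big_setD1 u) ?setU11 //= addnC leq_add //; last first.
    by apply: leq_trans (degH u); apply/subset_leq_card/subsetP => y; rewrite !inE => /andP[].
  rewrite [X in (_ <= X)%N](bigID (fun x => x == u)) /=.
  apply: leq_trans (leq_addl _ _); apply: eq_leq; apply: eq_bigl => x.
  by rewrite !inE; case: (x == u) => //=; rewrite ?andbF ?andbT.
have out : \sum_(Y : {set V} | (Y \subset U) && attached X Y && (u \notin Y)) q ^+ #|Y|
    <= b ^+ edges_into X (U :\ u).
  apply: le_trans (IH X (U :\ u) Uu).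
  rewrite le_eqVlt; apply/orP; left; apply/eqP; apply: eq_bigl => Y.
  by rewrite subsetD1 andbAC.
have inn : \sum_(Y : {set V} | (Y \subset U) && attached X Y && (u \in Y)) q ^+ #|Y|
    <= q * b ^+ edges_into (u |: X) (U :\ u).
  apply: (@le_trans _ _ (q * \sum_(Y : {set V} | (Y \subset U :\ u) && attached (u |: X) Y) q ^+ #|Y|)); last first.
    by rewrite ler_wpM2l // IH.
  rewrite mulr_sumr (reindex_onto (fun Y => u |: Y) (fun Y => Y :\ u)) /=; last first.
    by move=> Y /andP[_ uY]; rewrite setD1K.
  rewrite big_mkcond [X in _ <= X]big_mkcond /=; apply: ler_sum => Y _.
  case: ifP => [/andP[/andP[/andP[YU att] _] /eqP eY]|_]; last first.
    by case: ifP => // _; rewrite mulr_ge0 ?exprn_ge0.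
  have uY : u \notin Y by rewrite -eY !inE eqxx.
  have -> : (Y \subset U :\ u) && attached (u |: X) Y.
    rewrite subsetD1 uY andbT; apply/andP; split.
      by apply: subset_trans YU; exact: subsetUr.
    by rewrite -{1}eY; apply: attachedD1 att; exact: setU11.
  by rewrite cardsU1 uY add1n exprS.
rewrite addrC; apply: le_trans (lerD out inn) _.
apply: (@le_trans _ _ (b ^+ edges_into X (U :\ u) * (1 + q * b ^+ D))).
  rewrite mulrDr mulr1 lerD2l mulrCA ler_wpM2l //.
  by rewrite -exprD ler_weXn2l.
(* Since [b ^+ D <= 2], the factor [1 + q * b ^+ D] is at most [b], which the lost edge from [x0] to
   [u] pays for. *)
apply: (@le_trans _ _ (b ^+ (edges_into X (U :\ u)).+1)); last by rewrite ler_weXn2l.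
rewrite exprSr ler_wpM2l ?exprn_ge0 ?(le_trans ler01) //.
by rewrite /b lerD2l mulrC ler_wpM2r.
Qed.

End Attached.

(** * Weighted sums over labellings *)

Section Labels.
Variables (V : finType) (H : rel V) (R : realFieldType).

Lemma sum_geometric_le (q : R) (L : nat) :
  0 <= q -> q <= 1 / 2 -> \sum_(i < L) q ^+ i <= 2.
Proof.
(* The extra term [2 * q ^+ L] closes the induction: it absorbs the next summand because
   [2 * q <= 1]. *)
move=> q0 q2; suff: \sum_(i < L) q ^+ i + 2 * q ^+ L <= 2.
  by apply: le_trans; rewrite lerDl mulr_ge0 ?exprn_ge0.
elim: L => [|L IH]; first by rewrite big_ord0 add0r mulr1.
rewrite big_ord_recr /=; apply: le_trans IH.
rewrite -addrA lerD2l exprS.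
have : 0 <= q ^+ L * (1 - 2 * q) by rewrite mulr_ge0 ?exprn_ge0 //; lra.
lra.
Qed.

(** Group the labellings by their support [Y]. A vertex of [Y] contributes the sum of [q ^+ i] over
    positive [i], at most [2 * q], and any other vertex contributes 1; then [sum_attached] applies
    with weight [2 * q]. *)
Lemma sum_attached_labels (q : R) (D L : nat) (X : {set V}) :
  0 <= q -> q <= 1 / 2 -> (forall x, (#|[set y | H x y]| <= D)%N) ->
  (1 + 4 * q) ^+ D <= 2 ->
  \sum_(l : {ffun V -> 'I_L.+1} | attached H X [set u | l u != ord0])
      \prod_u q ^+ l u
    <= (1 + 4 * q) ^+ (#|X| * D).
Proof.
move=> q0 q2 degH bD.
have e4 : 1 + 4 * q = 1 + 2 * (2 * q) by ring.
have q20 : 0 <= 2 * q by rewrite mulr_ge0.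
apply: (@le_trans _ _ (\sum_(Y : {set V} | attached H X Y) (2 * q) ^+ #|Y|)).
  rewrite (partition_big (fun l : {ffun V -> 'I_L.+1} => [set u | l u != ord0])
             (attached H X)) //=.
  apply: ler_sum => Y attY.
  rewrite (eq_bigl (fun l : {ffun V -> 'I_L.+1} =>
      l \in family (fun u => [pred i : 'I_L.+1 | (i != ord0) == (u \in Y)]))); last first.
    move=> l; apply/andP/familyP => [[_ /eqP <-] u|lY]; first by rewrite !inE.
    have -> : [set u | l u != ord0] = Y.
      by apply/setP => u; rewrite inE; have := lY u; rewrite inE => /eqP.
    by [].
  have := @bigA_distr_big_dep R 0 1 *%R +%R V 'I_L.+1
    (fun u => [pred i : 'I_L.+1 | (i != ord0) == (u \in Y)]) (fun _ i => q ^+ i).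
  rewrite /= => <-.
  rewrite -[X in _ <= X](prodr_const) [X in _ <= X]big_mkcond /=.
  apply: ler_prod => u _; rewrite sumr_ge0 /=; last by move=> *; exact: exprn_ge0.
  case: (boolP (u \in Y)) => uY.
    under eq_bigl do rewrite eqb_id.
    rewrite big_mkcond big_ord_recl /= add0r.
    under eq_bigr do rewrite /= exprS.
    by rewrite -mulr_sumr mulrC ler_wpM2r ?sum_geometric_le.
  rewrite (big_pred1 ord0) ?expr0 // => i /=.
  by rewrite eqbF_neg negbK.
rewrite e4; apply: (@le_trans _ _ ((1 + 2 * (2 * q)) ^+ edges_into H X setT)).
  apply: le_trans (sum_attached (D := D) _ setT q20 degH _); last by rewrite -e4.
  by under [X in _ <= X]eq_bigl do rewrite subsetT.
apply: ler_weXn2l; first by rewrite lerDl mulr_ge0.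
rewrite -sum_nat_const; apply: leq_sum => x _; apply: leq_trans (degH x).
by apply/subset_leq_card/subsetP => y; rewrite !inE.
Qed.

End Labels.

Lemma sum_ord_lt (L m : nat) : (\sum_(i < L) (i < m) = minn m L)%N.
Proof.
elim: L => [|L IH]; first by rewrite big_ord0 minn0.
by rewrite big_ord_recr /= IH; lia.
Qed.

(** * Greedy encoding of the superlevel sets *)

Section Levels.
Variables (V : finType) (e : rel V) (d : nat).
Hypothesis e_sym : symmetric e.
Hypothesis e_reg : regular e d.

(* The vertices having at least 9/10 of their neighbours in [F]. *)
Definition core (F : {set V}) : {set V} :=
  [set s | (9 * d <= 10 * #|[set u in F | e s u]|)%N].

(** In the notation of the overview, [superlevel l i] is Y_i, [reach X l i] is F_i and the [core] of
    the latter is S_i. *)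
Definition superlevel (l : V -> nat) (i : nat) : {set V} :=
  [set u | (i < l u)%N].

Definition reach (X : {set V}) (l : V -> nat) (i : nat) : {set V} :=
  cnbhd e ((if i == 0%N then X else set0) :|: superlevel l i).

Definition label (L : nat) (l : {ffun V -> 'I_L.+1}) : V -> nat :=
  fun u => l u.

(* Take [Z] maximal: a vertex of [A] violating the last condition could still
   be added to it. *)
Lemma greedy_extension (A B Y : {set V}) :
  Y \subset A -> (d * #|Y| <= 10 * #|cnbhd e (B :|: Y)|)%N ->
  exists Z : {set V}, [/\ Y \subset Z, Z \subset A,
    (d * #|Z| <= 10 * #|cnbhd e (B :|: Z)|)%N &
    A \subset core (cnbhd e (B :|: Z))].
Proof.
move=> YA gY.
pose P := [pred Z : {set V} | (Z \subset A) && (d * #|Z| <= 10 * #|cnbhd e (B :|: Z)|)%N].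
have PY : P Y by rewrite /= YA.
have [Z /maxsetP[/andP[ZA gZ] maxZ] YZ] := maxset_exists PY.
exists Z; split=> //; apply/subsetP => a aA; rewrite inE leqNgt; apply/negP => few.
have part : (#|[set u in cnbhd e (B :|: Z) | e a u]|
             + #|[set u | e a u] :\: cnbhd e (B :|: Z)|)%N = d.
  rewrite -(e_reg a) -[in RHS](cardsID (cnbhd e (B :|: Z))); congr (_ + _)%N.
  by apply: eq_card => u; rewrite !inE andbC.
have : a |: Z = Z.
  apply: maxZ; last exact: subsetUr.
  rewrite /= subUset sub1set aA ZA /=.
  have sub : cnbhd e (B :|: Z) :|: ([set u | e a u] :\: cnbhd e (B :|: Z))
              \subset cnbhd e (B :|: (a |: Z)).
    rewrite subUset cnbhdS ?setUS ?subsetUr //=.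
    apply/subsetP => u /setDP[]; rewrite inE => au _.
    by apply/cnbhdP; exists a; rewrite ?au ?orbT // !inE eqxx orbT.
  have := subset_leq_card sub; rewrite cardsU.
  have -> : cnbhd e (B :|: Z) :&: ([set u | e a u] :\: cnbhd e (B :|: Z)) = set0.
    by apply/setP => u; rewrite !inE; case: (u \in _).
  rewrite cards0 subn0 cardsU1; case: (a \notin Z); nia.
(* Maximality puts [a] in [Z]; then all neighbours of [a] are covered, against [few]. *)
move/setP/(_ a); rewrite !inE eqxx /= => /esym aZ.
move: few; have -> : [set u in cnbhd e (B :|: Z) | e a u] = [set u | e a u].
  apply/setP => u; rewrite !inE; case: (boolP (e a u)) => au; rewrite ?andbF ?andbT //.
  by apply/cnbhdP; exists a; rewrite ?au ?orbT // inE aZ orbT.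
by rewrite e_reg; lia.
Qed.

(** The set chosen at level [j] extends the one chosen at level [j.+1], so the chosen sets are
    nested and are the superlevel sets of a single labelling. *)
Lemma greedy_levels (A : nat -> {set V}) (X : {set V}) (L : nat) :
  (forall i, A i.+1 \subset A i) ->
  exists l : {ffun V -> 'I_L.+1}, forall i, (i < L)%N ->
    [/\ superlevel (label l) i \subset A i,
        (d * #|superlevel (label l) i| <= 10 * #|reach X (label l) i|)%N &
        A i \subset core (reach X (label l) i)].
Proof.
move=> decA.
suff [l lL lP] : exists2 l : V -> nat, forall u, (l u <= L)%N &
    forall i, (L - L <= i < L)%N ->
    [/\ superlevel l i \subset A i,
        (d * #|superlevel l i| <= 10 * #|reach X l i|)%N &
        A i \subset core (reach X l i)].
  exists [ffun u => inord (l u)] => i iL.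
  have eqS : superlevel (label [ffun u => inord (l u) : 'I_L.+1]) i = superlevel l i.
    by apply/setP => u; rewrite !inE /label ffunE inordK // ltnS.
  by rewrite /reach eqS; apply: lP; rewrite subnn.
(* Induction on the number [k] of top levels already treated. *)
suff: forall k, exists2 l : V -> nat, forall u, (l u <= L)%N &
    forall i, (L - k <= i < L)%N ->
    [/\ superlevel l i \subset A i,
        (d * #|superlevel l i| <= 10 * #|reach X l i|)%N &
        A i \subset core (reach X l i)] by [].
elim=> [|k [l lL lP]].
  by exists (fun=> 0%N) => // i; rewrite subn0 => /andP[/leq_ltn_trans h /h]; rewrite ltnn.
case: (leqP L k) => Lk.
  by exists l => // i /andP[_ iL]; apply: lP; lia.
have [j jk jL] : exists2 j, (L - k = j.+1)%N & (j < L)%N.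
  by exists (L - k.+1)%N; lia.
have [subj goodj] : superlevel l j.+1 \subset A j.+1 /\
    (d * #|superlevel l j.+1| <= 10 * #|cnbhd e (superlevel l j.+1)|)%N.
  have [jL'|Lj] := ltnP j.+1 L.
    by have [|? + _] := lP j.+1; [rewrite jk leqnn | rewrite /reach set0U].
  have -> : superlevel l j.+1 = set0.
    by apply/setP => u; rewrite !inE; apply/negbTE; rewrite -leqNgt; exact: leq_trans (lL u) Lj.
  by rewrite cards0 muln0 sub0set.
have [|Z [YZ ZA goodZ coreZ]] := greedy_extension (B := if j == 0%N then X else set0)
    (subset_trans subj (decA j)).
  apply: leq_trans goodj _; rewrite leq_mul2l; apply/orP; right.
  by apply/subset_leq_card/cnbhdS/subsetUr.
(* Label [j.+1] puts the new vertices of [Z] into superlevel [j] and leaves the higher superlevels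
   unchanged. *)
pose l' u := if (j.+1 < l u)%N then l u else if u \in Z then j.+1 else 0%N.
have eqj : superlevel l' j = Z.
  apply/setP => u; rewrite inE /l'; case: ifP => [jl|_].
    by rewrite (ltn_trans _ jl) //; apply/esym/(subsetP YZ); rewrite inE.
  by case: ifP => _; rewrite ?ltnSn.
have eqi i : (j < i)%N -> superlevel l' i = superlevel l i.
  move=> ji; apply/setP => u; rewrite !inE /l'; case: ifP => // jl.
  have -> : (i < l u)%N = false by apply/negbTE; lia.
  by case: ifP => _; apply/negbTE; lia.
exists l' => [u|i /andP[ji iL]]; first by rewrite /l'; case: ifP => // _; case: ifP.
have [->|ij] := eqVneq i j; first by rewrite /reach eqj.
have ji' : (j < i)%N by lia.
by rewrite /reach eqi //; apply: lP; lia.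
Qed.

(** The step length is 7 = 2 + 3 + 2. If [T] were a cut, induction along [r]-paths would place every
    vertex of the component within 2 of [X :|: T]: a centre outside [X :|: T] serving the next
    vertex would be within 7 of an earlier centre. A vertex of [Y :\: T] then gives a
    contradiction. *)
Lemma attached_component (r : rel V) (v : V) (X Y : {set V}) :
  (forall x y, r x y -> near e 3 x y) -> v \in X ->
  (forall y, y \in Y -> connect r v y) ->
  (forall a, connect r v a -> exists2 x, x \in X :|: Y & near e 2 x a) ->
  attached (near e 7) X Y.
Proof.
move=> r3 vX Yv cov; apply/attachedP => T /properP[TY [y yY yT]].
apply: contrapT => noH.
have near2 a : connect r v a -> exists2 x, x \in X :|: T & near e 2 x a.
  move=> /connectP[p]; elim/last_ind: p a => [|p b IH] a /=.
    by move=> _ ->; exists v; [rewrite inE vX | apply: near_leq (near0 _ _)].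
  rewrite rcons_path last_rcons => /andP[pp rab] ->.
  have vb : connect r v b.
    by apply/connectP; exists (rcons p b); rewrite ?rcons_path ?pp ?last_rcons.
  have [x xXT xa] := IH _ pp erefl.
  have [x' x'XY x'b] := cov b vb.
  have [x'T|x'T] := boolP (x' \in X :|: T); first by exists x'.
  case: noH; exists x, x'; split=> //.
    by move: x'XY x'T; rewrite !inE; case: (x' \in X) => //= -> ->.
  apply: (@near_trans _ _ 5 2) (near_sym e_sym x'b).
  by apply: (@near_trans _ _ 2 3) xa _; exact: r3.
have [x xXT xy] := near2 y (Yv y yY).
by apply: noH; exists x, y; split; rewrite // ?inE ?yT ?yY //; apply: near_leq xy.
Qed.

(** The vertices left free in the counting: F_0, and the part of S_0 where [h] is positive. *)
Definition active (X : {set V}) (l : V -> nat) (h : V -> int) : {set V} :=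
  reach X l 0 :|: [set s in core (reach X l 0) | 1 <= h s].

Definition height (L : nat) (X : {set V}) (l : V -> nat) (u : V) : nat :=
  (\sum_(i < L) (u \in core (reach X l i)))%N.

Lemma in_core (F : {set V}) (s : V) :
  (0 < d)%N -> s \in core F -> exists2 u, u \in F & e s u.
Proof.
move=> d0; rewrite inE => sF.
have /card_gt0P[u] : (0 < #|[set u in F | e s u]|)%N by lia.
by rewrite inE => /andP[uF su]; exists u.
Qed.

(** The lower bound holds because a vertex of F_i equals or neighbours a vertex above M + i. An
    active vertex is within 2 of the component of [v]; if it has height M + m with m > 0, it belongs
    to the component, hence to A_i and S_i for all i < m. A neighbour above M of an active vertex is
    within 3 of the component, hence in it, in S_0, and active: this is why the component uses
    distance 3. *)
Lemma level_structure (h : V -> int) (M L s : nat) (v : V) :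
  let X := [set u | near e s v u] in
  (0 < d)%N ->
  (forall u w, e u w -> `|h u - h w| <= M%:Z) ->
  (forall u, h u <= M%:Z + L%:Z) ->
  (forall u, u \in X -> M%:Z < h u) ->
  exists l : {ffun V -> 'I_L.+1},
  [/\ forall i u, (i < L)%N -> u \in reach X (label l) i -> i%:Z < h u,
      forall u, u \in active X (label l) h -> h u <= M%:Z + (height L X (label l) u)%:Z,
      forall u w, u \in active X (label l) h -> w \notin active X (label l) h -> e u w ->
        h w <= M%:Z,
      attached (near e 7) X [set u | l u != ord0] &
      forall i, (i < L)%N ->
        (d * #|superlevel (label l) i| <= 10 * #|reach X (label l) i|)%N].
Proof.
move=> X d0 Lh hL hX.
have vX : v \in X by rewrite inE; apply: near_leq (near0 _ _).
have L0 : (0 < L)%N by have := hL v; have := hX v vX; lia.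
pose r : rel V := fun x y => [&& M%:Z < h x, M%:Z < h y & near e 3 x y].
pose A i := [set u | connect r v u & M%:Z + i%:Z < h u].
have decA i : A i.+1 \subset A i.
  by apply/subsetP => u; rewrite !inE => /andP[-> /=]; lia.
have inA u : connect r v u -> M%:Z < h u.
  move=> /connectP[p]; elim/last_ind: p => [_ ->|p w _]; first exact: hX.
  by rewrite rcons_path last_rcons => /andP[_ /and3P[_ hw _]] ->.
have XA x : x \in X -> connect r v x.
  rewrite inE; elim: {-2}s (leqnn s) x => [|m IH] ms x.
    by move=> /set1P->; exact: connect0.
  move=> /[dup] vx /nearSP[w vw wx].
  apply: connect_trans (IH (ltnW ms) w vw) (connect1 _).
  rewrite /r !hX ?inE ?(near_leq ms vx) ?(near_leq (ltnW ms) vw) //=.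
  by apply: near_leq (nearS (near0 _ _) wx).
have [l lP] := greedy_levels X L decA.
exists l.
have [sub0 _ core0] := lP 0%N L0.
have reachA i u : (i < L)%N -> u \in reach X (label l) i ->
    exists2 x, connect r v x /\ M%:Z + i%:Z < h x & (u == x) || e x u.
  move=> iL /cnbhdP[x + xu]; have [subi _ _] := lP i iL.
  rewrite inE => /orP[|xl]; last first.
    by exists x => //; have := subsetP subi x xl; rewrite inE => /andP[].
  case: eqP => [->|_] xX; last by rewrite inE in xX.
  by exists x => //; split; [exact: XA | rewrite addr0 hX].
have near_active u : u \in active X (label l) h -> exists2 x, connect r v x & near e 2 x u.
  rewrite inE => /orP[uF|].
    have [x [vx _] xu] := reachA 0%N u L0 uF.
    by exists x => //; apply: near_leq (nearS (near0 _ _) xu).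
  rewrite inE => /andP[/(in_core d0)[w wF uw] _].
  have [x [vx _] xw] := reachA 0%N w L0 wF.
  exists x => //; apply: nearS (nearS (near0 _ _) xw) _.
  by rewrite e_sym uw orbT.
have closed x u : connect r v x -> near e 3 x u -> M%:Z < h u -> connect r v u.
  move=> vx xu hu; apply: (connect_trans vx); apply: connect1.
  by rewrite /r hu xu inA.
split.
- move=> i u iL /(reachA i u iL)[x [_ hx] /orP[/eqP->|xu]]; first by lia.
  by have := Lh x u xu; rewrite ler_norml; lia.
- move=> u uW; have [uM|uM] := leP (h u) M%:Z; first by lia.
  have [x vx xu] := near_active u uW.
  have vu : connect r v u by apply: closed vx _ uM; apply: near_leq xu.
  have [m hm] : exists m : nat, h u = M%:Z + m%:Z.
    by exists (absz (h u - M%:Z)); lia.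
  have mL : (m <= L)%N by have := hL u; lia.
  rewrite hm lerD2l lez_nat /height.
  rewrite -{1}(minn_idPl mL) -sum_ord_lt; apply: leq_sum => i _.
  case: (ltnP i m) => // im; have [_ _ /subsetP/(_ u) ->//] := lP i (ltn_ord i).
  by rewrite inE vu hm ltrD2l ltz_nat.
- move=> u w uW wW uw; rewrite leNgt; apply/negP => hw.
  have [x vx xu] := near_active u uW.
  move/negP: wW; apply; rewrite inE; apply/orP; right.
  rewrite inE; apply/andP; split; last by lia.
  apply: (subsetP core0); rewrite inE addr0 hw andbT.
  by apply: closed vx _ hw; apply: nearS xu _; rewrite uw orbT.
- apply: (@attached_component r v) => // [x y /and3P[]//|y|a va].
    by rewrite inE -lt0n => ly; have := subsetP sub0 y; rewrite !inE => /(_ ly)/andP[].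
  have [|w wF aw] := @in_core (reach X (label l) 0) a d0.
    by apply: (subsetP core0); rewrite inE va addr0 inA.
  have /cnbhdP[x xX xw] := wF; exists x.
    by move: xX; rewrite !inE lt0n.
  by apply: nearS (nearS (near0 _ _) xw) _; rewrite e_sym aw orbT.
by move=> i /lP[].
Qed.

End Levels.

(** * Counting functions in products of intervals, and comparison by fibres *)

Section Boxes.
Variable V : finType.
Implicit Types (W : {set V}) (f g : {ffun V -> int}) (c : V -> nat).

Lemma card_family_box (N : nat) W c :
  (forall u, (c u <= N)%N) ->
  #|family (fun u => [pred i : 'I_N.+1 | if u \in W then (i < c u)%N else i == ord0])|
    = (\prod_(u in W) c u)%N.
Proof.
move=> cN; rewrite card_family foldrE big_map big_enum /= [RHS]big_mkcond /=.
apply: eq_bigr => u _; case: (u \in W) => /=; last exact: card1.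
have := @big_ord_widen _ 0%N addn _ N.+1 (fun=> 1%N) (leqW (cN u)).
by rewrite sum1_card card_ord => cE; rewrite [RHS]cE -sum1_card.
Qed.

Lemma card_box_le (X : seq {ffun V -> int}) W f (lo : V -> int) c :
  uniq X ->
  (forall (g : {ffun V -> int}) u, g \in X -> u \notin W -> g u = f u) ->
  (forall (g : {ffun V -> int}) u, g \in X -> u \in W -> lo u <= g u < lo u + (c u)%:Z) ->
  (size X <= \prod_(u in W) c u)%N.
Proof.
move=> uX outX inX; pose N := (\sum_u c u)%N.
have cN u : (c u <= N)%N by rewrite /N (bigD1 u) //= leq_addr.
rewrite -(card_family_box W cN) cardE.
pose phi g : {ffun V -> 'I_N.+1} :=
  [ffun u => if u \in W then inord (absz (g u - lo u)) else ord0].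
have phiE g u : g \in X -> u \in W -> phi g u = absz (g u - lo u) :> nat.
  move=> gX uW; rewrite ffunE uW inordK //.
  by have := inX g u gX uW; have := cN u; lia.
rewrite -(size_map phi); apply: uniq_leq_size.
  rewrite map_inj_in_uniq // => g g' gX g'X eqg; apply/ffunP => u.
  have [uW|uW] := boolP (u \in W); last by rewrite !outX.
  have := phiE g u gX uW; rewrite eqg phiE //.
  have := inX g u gX uW; have := inX g' u g'X uW.
  by move: (g u) (g' u) (lo u) (c u) => a b x n; lia.
move=> _ /mapP[g gX ->]; rewrite mem_enum; apply/familyP => u; rewrite inE.
case: ifP => uW; last by rewrite ffunE uW.
by rewrite phiE //; have := inX g u gX uW; lia.
Qed.

Lemma card_box_ge (Y : seq {ffun V -> int}) W f (lo : V -> int) c :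
  (forall g, (forall u, u \notin W -> g u = f u) ->
     (forall u, u \in W -> lo u <= g u < lo u + (c u)%:Z) -> g \in Y) ->
  (\prod_(u in W) c u <= size Y)%N.
Proof.
move=> inY; pose N := (\sum_u c u)%N.
have cN u : (c u <= N)%N by rewrite /N (bigD1 u) //= leq_addr.
rewrite -(card_family_box W cN) cardE.
set P := family _; pose psi (i : {ffun V -> 'I_N.+1}) : {ffun V -> int} :=
  [ffun u => if u \in W then lo u + (i u)%:Z else f u].
have enumP i u : i \in enum P -> if u \in W then (i u < c u)%N else i u == ord0.
  by rewrite mem_enum => /familyP/(_ u); rewrite inE.
rewrite -(size_map psi); apply: uniq_leq_size.
  rewrite map_inj_in_uniq ?enum_uniq // => i j iP jP /ffunP eqij.
  apply/ffunP => u; have := eqij u; rewrite !ffunE.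
  have := enumP i u iP; have := enumP j u jP; case: (u \in W).
    by move=> _ _ /addrI[/ord_inj].
  by move=> /eqP-> /eqP->.
move=> _ /mapP[i iP ->]; apply: inY => u uW; rewrite ffunE.
  by rewrite (negbTE uW).
have := enumP i u iP; rewrite uW lerDl ltrD2l ltz_nat => ->.
by rewrite andbT.
Qed.

End Boxes.

(** One fibre of [key] is removed from both sequences at a time; fibres of [Y] that do not meet [X]
    only enlarge the right-hand side. *)
Lemma size_le_fibers (R : numDomainType) (T K : eqType) (key : T -> K)
    (rho : R) (X Y : seq T) :
  (forall x, x \in X -> (count (fun y => key y == key x) X)%:R
     <= rho * (count (fun y => key y == key x) Y)%:R) -> 0 <= rho ->
  (size X)%:R <= rho * (size Y)%:R.
Proof.
move=> + rho0; have [n] := ubnP (size X).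
elim: n X Y => // n IH [|x X] Y sX fib; first by rewrite mulr_ge0.
pose p := fun y => key y == key x.
have split_size Z : size Z = (count p Z + size [seq y <- Z | ~~ p y])%N.
  by rewrite size_filter count_predC.
rewrite (split_size (x :: X)) (split_size Y) (natrD _ (count p (x :: X))).
rewrite (natrD _ (count p Y)) mulrDr.
apply: lerD; first by apply: fib; exact: mem_head.
apply: IH => [|y].
  move: sX; rewrite /= /p eqxx /= size_filter => sX.
  by apply: leq_ltn_trans (count_size _ _) _.
rewrite mem_filter => /andP[yx yX]; have := fib y yX.
have keep Z : count (fun z => key z == key y) [seq z <- Z | ~~ p z]
    = count (fun z => key z == key y) Z.
  rewrite count_filter; apply: eq_count => z /=; rewrite /p.
  by case: eqP => //= ->; rewrite yx.
by rewrite !keep.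
Qed.

(** * Comparison of counts when all values outside a window are frozen *)

Section Counting.
Variables (R : realType) (V : finType) (e : rel V).
Hypothesis e_sym : symmetric e.
Variables (d M : nat) (lambda : R) (k : int).
Hypothesis M_gt0 : (0 < M)%N.

(** The normal values [k], ..., [k + M] become -M, ..., 0, so a positive relative height marks an
    outlier. *)
Definition rel_height (f : {ffun V -> int}) (u : V) : int := f u - k - M%:Z.

Local Notation h := rel_height.

Definition window (F S : {set V}) (f : {ffun V -> int}) : {set V} :=
  F :|: [set s in S | 1 <= h f s].

Lemma count_ratio (up lo : nat) (x r : int) (inF : bool) :
  (inF || (lo == 0%N)) ->
  1 <= r <= M%:Z -> (if inF then lo%:Z else 1) <= x ->
  x <= (if r == M%:Z then M%:Z + up%:Z else r) ->
  (absz ((if r == M%:Z then M%:Z + up%:Z else r)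
     - (if inF then lo%:Z else 1) + 1))%:R
    <= expR (up%:R / M%:R - lo%:R / M.+1%:R) * (absz r + inF)%:R :> R.
Proof.
move=> F0 /andP[r1 rM] lox xup.
have [n rn] : exists n : nat, r = n%:Z by exists (absz r); lia.
move: r1 rM xup; rewrite {}rn eqz_nat !lez_nat absz_nat => n1 nM xup.
have Mr : 0 < M%:R :> R by rewrite ltr0n.
have M1r : 0 < M.+1%:R :> R by rewrite ltr0n.
have Mne : M%:R != 0 :> R by rewrite gt_eqF.
have M1ne : M.+1%:R != 0 :> R by rewrite gt_eqF.
apply: (@le_trans _ _ ((1 + (up%:R / M%:R - lo%:R / M.+1%:R)) * (n + inF)%:R)); last first.
  by rewrite ler_wpM2r // expR_ge1Dx.
set a := up%:R / M%:R; have a0 : 0 <= a by rewrite divr_ge0.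
have aM : a * M%:R = up%:R by rewrite mulfVK.
set b := lo%:R / M.+1%:R; have b0 : 0 <= b by rewrite divr_ge0.
have bM : b * M.+1%:R = lo%:R by rewrite mulfVK.
have M1 : M.+1%:R = M%:R + 1 :> R by rewrite -natr1.
rewrite M1 in bM.
case: inF F0 lox => /= [_|/eqP lo0] lox; case: eqP => [nM'|nM'] in xup *.
- have -> : absz (M%:Z + up%:Z - lo%:Z + 1) = (M + up + 1 - lo)%N by lia.
  rewrite natrB; last by lia.
  rewrite nM' !natrD -aM -bM; nra.
- have -> : absz (n%:Z - lo%:Z + 1) = (n + 1 - lo)%N by lia.
  rewrite natrB; last by lia.
  have nMr : n%:R <= M%:R :> R by rewrite ler_nat.
  have n0r : 0 <= n%:R :> R by [].
  rewrite !natrD -bM; nra.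
- have -> : absz (M%:Z + up%:Z - 1 + 1) = (M + up)%N by lia.
  have b00 : b = 0 by rewrite /b lo0 mul0r.
  rewrite nM' addn0 natrD -aM b00; lra.
- have -> : absz (n%:Z - 1 + 1) = n by lia.
  have b00 : b = 0 by rewrite /b lo0 mul0r.
  have n0r : 0 <= n%:R :> R by [].
  rewrite addn0 b00; nra.
Qed.

(* Freeze [f] outside its window; inside, [f] lies in a product of intervals,
   to be compared with the product of the intervals of admissible relative
   heights in [0, M] (in [1, M] outside [F]). The latter functions belong to
   [Lip_star], have the same window, and no new outliers. *)
Lemma count_by_window (F S : {set V}) (lo up : V -> nat)
    (B A : seq {ffun V -> int}) :
  (forall u, u \notin F -> lo u = 0%N) ->
  uniq B ->
  (forall f, f \in A <-> Lip_star e d lambda M k f) ->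
  {subset B <= A} ->
  (forall (f : {ffun V -> int}) u, f \in B -> u \in F -> (lo u)%:Z <= h f u /\ 1 <= h f u) ->
  (forall (f : {ffun V -> int}) u, f \in B -> u \in window F S f -> h f u <= M%:Z + (up u)%:Z) ->
  (forall (f : {ffun V -> int}) u w, f \in B -> u \in window F S f -> w \notin window F S f ->
     e u w -> h f w <= M%:Z) ->
  (size B)%:R
    <= expR (\sum_u ((up u)%:R / M%:R - (lo u)%:R / M.+1%:R)) * (size A)%:R :> R.
Proof.
move=> lo0 uB AP BA loB upB outB.
(* The key records what is frozen: the window and the values outside it, with 0 as a placeholder
   inside. *)
pose key f := (window F S f, [ffun u => if u \in window F S f then 0 else f u]).
suff fiber (f : {ffun V -> int}) : f \in B ->
    (count (fun g => key g == key f) B)%:R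
      <= expR (\sum_u ((up u)%:R / M%:R - (lo u)%:R / M.+1%:R))
         * (count (fun g => key g == key f) A)%:R :> R.
  by apply: (size_le_fibers (key := key)) => //; exact: expR_ge0.
move=> fB; set W := window F S f.
have /AP[Lf outf] := BA f fB.
have h1 u : u \in W -> 1 <= h f u.
  by rewrite inE => /orP[/(loB f u fB)[]//|]; rewrite inE => /andP[].
pose r u : int := \big[Order.min/M%:Z]_(w | (w \notin W) && e u w) (M%:Z + h f w).
have rM u : r u <= M%:Z by exact: bigmin_le_id.
have rle u w : w \notin W -> e u w -> r u <= M%:Z + h f w.
  by move=> wW uw; apply: bigmin_le_cond; rewrite wW.
have ger u x : x <= M%:Z ->
    (forall w, w \notin W -> e u w -> x <= M%:Z + h f w) -> x <= r u.
  by move=> xM xw; apply/bigmin_geP; split=> // w /andP[]; exact: xw.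
have Lh u w : e u w -> h f u - h f w <= M%:Z.
  by move=> uw; have := Lf u w uw; rewrite /h ler_norml; lia.
have r1 u : u \in W -> 1 <= r u.
  move=> uW; apply: ger => [|w _ uw]; first by lia.
  by have := Lh u w uw; have := h1 u uW; lia.
pose low u : int := if u \in F then (lo u)%:Z else 1.
(* A height above [M] at [u] forces [r u] to equal [M]; otherwise [r u] itself is the upper
   limit. *)
pose top u : int := if r u == M%:Z then M%:Z + (up u)%:Z else r u.
pose cX u := absz (top u - low u + 1).
pose cY u := (absz (r u) + (u \in F))%N.
have same (g : {ffun V -> int}) : key g == key f ->
    window F S g = W /\ forall u, u \notin W -> g u = f u.
  move=> /eqP[eqW /ffunP eqg]; split=> // u uW.
  by have := eqg u; rewrite !ffunE eqW -/W (negbTE uW).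
have boundX (g : {ffun V -> int}) u : g \in B -> key g == key f -> u \in W -> low u <= h g u <= top u.
  move=> gB /same[Wg gf] uW; have uWg : u \in window F S g by rewrite Wg.
  apply/andP; split.
    rewrite /low; case: ifPn => uF; first by have [] := loB g u gB uF.
    by move: uWg; rewrite !inE (negbTE uF) /= => /andP[].
  have /AP[Lg _] := BA g gB.
  have hge w : w \notin W -> e u w -> h g u <= M%:Z + h f w.
    by move=> wW uw; have := Lg u w uw; rewrite (gf w wW) /h ler_norml; lia.
  have := upB g u gB uWg; rewrite /top; case: (leP (h g u) M%:Z) => hM hup.
    by have := ger u _ hM hge; case: eqP; lia.
  have -> : r u = M%:Z; last by rewrite eqxx.
  apply: le_anti; rewrite rM; apply: ger => // w wW uw.
  by apply: le_trans (ltW hM) _; exact: hge.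
have leX : (count (fun g => key g == key f) B <= \prod_(u in W) cX u)%N.
  rewrite -size_filter.
  apply: (@card_box_le _ _ W f (fun u => k + M%:Z + low u)).
  - exact: filter_uniq.
  - by move=> g u; rewrite mem_filter => /andP[/same[_ +] _]; exact.
  - move=> g u; rewrite mem_filter => /andP[kg gB] uW.
    by have := boundX g u gB kg uW; rewrite /cX /h; lia.
have geY : (\prod_(u in W) cY u <= count (fun g => key g == key f) A)%N.
  rewrite -size_filter.
  apply: (@card_box_ge _ _ W f (fun u => k + M%:Z + (u \notin F)%:Z)) => g gf gW.
  have hgW u : u \in W -> (u \notin F)%:Z <= h g u <= r u.
    move=> uW; have := gW u uW; have := r1 u uW; rewrite /cY /h.
    by case: (u \in F) => /=; lia.
  have hgf w : w \notin W -> h g w = h f w by move=> wW; rewrite /h gf.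
  have Lg' u w : e u w -> h g u - h g w <= M%:Z.
    move=> uw; have [uW|uW] := boolP (u \in W); have [wW|wW] := boolP (w \in W).
    - by have := hgW u uW; have := hgW w wW; have := rM u; lia.
    - by rewrite (hgf w wW); have := hgW u uW; have := rle u w wW uw; lia.
    - rewrite (hgf u uW); have := hgW w wW.
      by have := outB f w u fB wW uW; rewrite e_sym => /(_ uw); lia.
    - by rewrite !hgf //; exact: Lh.
  have Wg : window F S g = W.
    apply/setP => u; have [uW|uW] := boolP (u \in W).
      have := uW; rewrite !inE; case: (boolP (u \in F)) => //= uF /andP[-> _] /=.
      by have := hgW u uW; rewrite uF; lia.
    by apply/negbTE; have := uW; rewrite !inE (hgf u uW).
  rewrite mem_filter; apply/andP; split.
    apply/eqP; rewrite /key Wg; congr (_, _).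
    by apply/ffunP => u; rewrite !ffunE; case: ifPn => // /gf.
  apply/AP; split.
    move=> u w uw; have := Lg' u w uw; have := Lg' w u; rewrite e_sym => /(_ uw).
    by rewrite /h ler_norml; lia.
  (* Vertices of the window were already outliers of [f]. *)
  apply: le_trans outf; rewrite ler_nat; apply/subset_leq_card/subsetP => u.
  rewrite !inE; have [uW|uW] := boolP (u \in W); last by rewrite gf.
  by have := h1 u uW; rewrite /h; lia.
apply: (@le_trans _ _ (\prod_(u in W) cX u)%:R); first by rewrite ler_nat.
apply: (@le_trans _ _ (expR (\sum_u ((up u)%:R / M%:R - (lo u)%:R / M.+1%:R))
    * (\prod_(u in W) cY u)%:R)); last first.
  by rewrite ler_wpM2l ?expR_ge0 // ler_nat.
apply: (@le_trans _ _ (expR (\sum_(u in W) ((up u)%:R / M%:R - (lo u)%:R / M.+1%:R))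
    * (\prod_(u in W) cY u)%:R)); last first.
  rewrite ler_wpM2r // ler_expR [X in _ <= X](bigID (mem W)) /= lerDl.
  apply: sumr_ge0 => u uW; rewrite lo0 ?mul0r ?subr0 ?divr_ge0 //.
  by apply: contra uW; rewrite inE => ->.
rewrite expR_sum !natr_prod -big_split /=; apply: ler_prod => u uW.
rewrite ler0n /=; apply: (@count_ratio _ _ (h f u)) => //.
- by case: (boolP (u \in F)) => //= /lo0->.
- by rewrite (r1 u uW) rM.
- by have /andP[] := boundX f u fB (eqxx _) uW.
- by have /andP[] := boundX f u fB (eqxx _) uW.
Qed.

End Counting.

(** * Consequences of expansion *)

Section Expander.
Variables (R : realType) (V : finType) (e : rel V) (d : nat) (lambda : R).
Hypothesis expd : expander e d lambda.

Lemma edge_count_sum (S T : {set V}) :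
  edge_count e S T = (\sum_(s in S) #|[set u in T | e s u]|)%N.
Proof.
rewrite /edge_count -sum1_card big_mkcond /=.
under eq_bigr do rewrite inE.
rewrite -(pair_bigA _ (fun s u => if [&& s \in S, u \in T & e s u] then 1%N else 0%N)) /=.
rewrite [RHS]big_mkcond /=; apply: eq_bigr => s _.
case: ifP => sS; last by rewrite big1.
by rewrite -sum1_card [RHS]big_mkcond; apply: eq_bigr => u _; rewrite inE.
Qed.

(** With S the core, at least (9d/10)|S| edges run from S to F, while expansion and the size of F
    allow at most 2 lambda |S| + lambda sqrt(|S||F|). As d >= 5 lambda, sqrt(|S||F|) >= (5/2)|S|, so
    |F| >= (25/4)|S|. *)
Lemma core_small (F : {set V}) :
  0 < lambda -> lambda <= d%:R / 5 ->
  #|F|%:R <= 2 * lambda / d%:R * #|V|%:R -> 6 * #|core e d F|%:R <= #|F|%:R :> R.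
Proof.
move=> l0 ld leF; have [_ expand] := expd.
set S := core e d F.
have dl : 5 * lambda <= d%:R by lra.
have d0 : 0 < d%:R :> R by lra.
have [n0|n0] := eqVneq (#|V|%:R : R) 0.
  suff -> : #|S|%:R = 0 :> R by rewrite mulr0.
  apply/eqP; rewrite pnatr_eq0 -leqn0; apply: leq_trans (max_card _) _.
  by rewrite leqn0 -(pnatr_eq0 R) n0.
have n0' : 0 < #|V|%:R :> R by rewrite lt_neqAle eq_sym n0 ler0n.
have many : 9 * d%:R * #|S|%:R <= 10 * (edge_count e S F)%:R :> R.
  rewrite -!natrM ler_nat edge_count_sum big_distrr /= mulnC -sum_nat_const.
  by apply: leq_sum => s; rewrite inE.
have few : (edge_count e S F)%:R <= 2 * lambda * #|S|%:R + lambda * Num.sqrt (#|S|%:R * #|F|%:R).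
  have /ler_normlP[_] := expand S F; rewrite lerBlDr addrC => /le_trans; apply.
  rewrite lerD2r.
  have -> : d%:R / #|V|%:R * #|S|%:R * #|F|%:R
      = d%:R / #|V|%:R * #|F|%:R * #|S|%:R :> R by ring.
  rewrite ler_wpM2r // mulrAC ler_pdivrMr //.
  apply: le_trans (ler_wpM2l (ltW d0) leF) _.
  by rewrite le_eqVlt; apply/orP; left; apply/eqP; field; rewrite gt_eqF.
set s := #|S|%:R in many few *; set f := #|F|%:R in few *.
have s0 : 0 <= s :> R by exact: ler0n.
have f0 : 0 <= f :> R by exact: ler0n.
set g := Num.sqrt (s * f) in few.
have g0 : 0 <= g by exact: sqrtr_ge0.
have gE : g * g = s * f by rewrite -expr2 sqr_sqrtr ?mulr_ge0.
have sg : 5 / 2 * s <= g.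
  rewrite -(ler_pM2l l0).
  have : 45 * lambda * s <= 9 * d%:R * s by rewrite ler_wpM2r //; lra.
  lra.
have [s00|s00] := eqVneq s 0; first by rewrite s00 mulr0.
have sp : 0 < s by rewrite lt_neqAle eq_sym s00.
rewrite -(ler_pM2l sp) -gE.
have : (5 / 2 * s) * (5 / 2 * s) <= g * g by apply: ler_pM => //; lra.
nra.
Qed.

(** Expansion between [v] and its neighbourhood gives d - d^2/n <= lambda sqrt d, and d <= n/2. *)
Lemma expander_sqrt_le (v : V) (c : R) :
  d%:R / 5 <= c * #|V|%:R -> c <= 1 / 10 -> Num.sqrt d%:R <= 2 * lambda.
Proof.
move=> dn c10; have [reg expand] := expd.
have [->|d0] := posnP d.
  rewrite sqrtr0; have := expand [set v] [set v].
  rewrite !cards1 !mulr1 sqrtr1 mulr1.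
  by move=> /(le_trans (normr_ge0 _)) l0; rewrite mulr_ge0.
have n0 : 0 < #|V|%:R :> R by rewrite ltr0n; apply/card_gt0P; exists v.
have := expand [set v] [set u | e v u].
rewrite edge_count_sum big_set1 cards1 reg mul1r.
have -> : #|[set u in [set u | e v u] | e v u]| = d.
  by rewrite -[RHS](reg v); apply: eq_card => u; rewrite !inE andbb.
move=> /ler_normlP[_]; rewrite mulr1.
set x := Num.sqrt d%:R.
have x0 : 0 < x by rewrite sqrtr_gt0 ltr0n.
have xE : d%:R = x * x by rewrite -expr2 sqr_sqrtr.
have half : d%:R / #|V|%:R * d%:R <= d%:R / 2 :> R.
  rewrite mulrC ler_wpM2l // ler_pdivrMr //.
  have : c * #|V|%:R <= 1 / 10 * #|V|%:R by rewrite ler_wpM2r // ltW.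
  lra.
move=> lx; rewrite -(ler_pM2r x0); lra.
Qed.

End Expander.

(** * Numerical estimates *)

Section Numerics.
Variable R : realType.

(** The constant is chosen so that [ln 2 / 5 <= 47 / 300]; it suffices that 1.195^4 > 2. *)
Lemma ln2_lt : ln 2 < 78 / 100 :> R.
Proof.
rewrite -[X in _ < X]expRK ltr_ln ?posrE ?expR_gt0 //.
have -> : 78 / 100 = 4%:R * (195 / 1000) :> R by field.
rewrite expRM_natl; apply: (@lt_le_trans _ _ ((1195 / 1000) ^+ 4)); first by lra.
apply: lerXn2r; rewrite ?nnegrE ?expR_ge0 //; first by lra.
by apply: le_trans (expR_ge1Dx _); lra.
Qed.

Lemma ln2_gt0 : 0 < ln 2 :> R.
Proof. by rewrite ln_gt0 // ltr1n. Qed.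

Lemma degree_bound (d M : nat) (lambda c : R) :
  (2 <= d)%N -> 0 < lambda -> 0 < c -> Num.sqrt d%:R <= 2 * lambda ->
  M%:R <= c * (d%:R `^ (3 / 2) / (lambda * log2 d%:R)) ->
  M%:R * ln d%:R <= 2 * c * d%:R.
Proof.
move=> d2 l0 c0 sl.
have d0 : 0 < d%:R :> R by rewrite ltr0n (ltn_trans _ d2).
have lnd : 0 < ln d%:R :> R by rewrite ln_gt0 // ltr1n.
have -> : d%:R `^ (3 / 2) = d%:R * Num.sqrt d%:R :> R.
  rewrite -powR12_sqrt ?ltW // -{2}(powRr1 (ltW d0)) -powRD ?(gt_eqF d0) ?implybT //.
  by congr (_ `^ _); field.
rewrite /log2 => Mle.
have : M%:R * ln d%:R <= c * (d%:R * (2 * lambda) / (lambda * (ln d%:R / ln 2))) * ln d%:R.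
  apply: le_trans (ler_wpM2r (ltW lnd) Mle) _.
  rewrite ler_wpM2r ?(ltW lnd) // ler_wpM2l ?(ltW c0) // ler_wpM2r ?ler_wpM2l ?(ltW d0) //.
  by rewrite invr_ge0 !mulr_ge0 ?invr_ge0 ?ltW // ln2_gt0.
move/le_trans; apply.
have -> : c * (d%:R * (2 * lambda) / (lambda * (ln d%:R / ln 2))) * ln d%:R
    = 2 * c * d%:R * ln 2 :> R.
  by field; rewrite !gt_eqF ?ln2_gt0.
rewrite ler_piMr ?mulr_ge0 ?ltW //.
by apply: lt_trans ln2_lt _; lra.
Qed.

(** The hypothesis says M ln d <= d / 1800, that is, q <= d^(-30). Half of this power absorbs
    (d+1)^7 <= d^14 and M <= d, the other half, at least 2^15, the constants. *)
Lemma weight_bound (d M : nat) :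
  (2 <= d)%N -> (0 < M)%N -> M%:R * ln d%:R <= 2 * (1 / 3600) * d%:R :> R ->
  let q : R := expR (- (d%:R / (60 * M%:R))) in
  q <= 1 / 2 /\ 4 * q * (d.+1 ^ 7)%:R <= 1 / (100 * M%:R).
Proof.
move=> d2 M0 Md q.
have dd : (d.+1 <= d * d)%N by move: d2; clear; nia.
have d0 : 0 < d%:R :> R by rewrite ltr0n (ltn_trans _ d2).
have dR2 : 2 <= d%:R :> R by rewrite ler_nat.
have M0r : 0 < M%:R :> R by rewrite ltr0n.
have q0 : 0 < q by exact: expR_gt0.
have qd : q * d%:R ^+ 30 <= 1.
  have -> : d%:R ^+ 30 = expR (30%:R * ln d%:R) :> R by rewrite expRM_natl lnK.
  rewrite -expRD -[X in _ <= X]expR0 ler_expR addrC subr_le0.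
  rewrite ler_pdivlMr ?mulr_gt0 //; lra.
have Mld : M%:R <= d%:R :> R.
  have ln2d : ln 2 <= ln d%:R :> R by rewrite ler_ln ?posrE.
  have l12 : 1 / 1800 <= ln 2 :> R.
    rewrite -[X in X <= _]expRK ler_ln ?posrE ?expR_gt0 //.
    have : 1 - 1 / 1800 <= expR (- (1 / 1800)) :> R by exact: expR_ge1Dx.
    rewrite expRN => h; rewrite -[X in X <= _]invrK invf_ple ?posrE ?invr_gt0 ?expR_gt0 //.
    by apply: le_trans h; lra.
  have : M%:R * (1 / 1800) <= M%:R * ln d%:R :> R.
    by rewrite ler_wpM2l // (le_trans l12).
  lra.
have d14 : (d.+1 ^ 7)%:R <= d%:R ^+ 14 :> R.
  rewrite -natrX ler_nat (expnM d 2 7) leq_exp2r //.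
have big : 2 ^+ 15 <= d%:R ^+ 15 :> R by apply: lerXn2r; rewrite ?nnegrE.
have d15 : 0 < d%:R ^+ 15 :> R by exact: exprn_gt0.
have qd15 : q * d%:R ^+ 15 <= 1 / 2 ^+ 15.
  rewrite ler_pdivlMr ?exprn_gt0 //; apply: le_trans qd.
  have -> : d%:R ^+ 30 = d%:R ^+ 15 * d%:R ^+ 15 :> R by rewrite -exprD.
  rewrite mulrA ler_wpM2l //.
  exact: mulr_ge0 (ltW q0) (ltW d15).
split.
  have : q * 2 ^+ 15 <= q * d%:R ^+ 15 :> R by rewrite ler_wpM2l ?(ltW q0).
  lra.
rewrite ler_pdivlMr ?mulr_gt0 //.
have : q * (d.+1 ^ 7)%:R * M%:R <= q * d%:R ^+ 15.
  rewrite -mulrA ler_wpM2l ?(ltW q0) //.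
  have -> : d%:R ^+ 15 = d%:R ^+ 14 * d%:R :> R by rewrite -exprSr.
  by apply: ler_pM.
lra.
Qed.

Lemma power_le_expR (q : R) (n : nat) : 0 <= q -> (1 + q) ^+ n <= expR (q * n%:R).
Proof.
move=> q0; rewrite mulrC expRM_natl; apply: lerXn2r; rewrite ?nnegrE ?expR_ge0 //.
  by rewrite addr_ge0.
exact: expR_ge1Dx.
Qed.

Lemma expR_hundredth : expR (1 / 100) <= 2 :> R.
Proof.
rewrite -[expR _]invrK -expRN invf_ple ?posrE ?expR_gt0 //.
by apply: le_trans (expR_ge1Dx _); lra.
Qed.

End Numerics.

(** * Proportion of the functions with a given label *)

Section LabelWeight.
Variables (R : realType) (V : finType) (e : rel V) (d : nat).

Definition depth (L : nat) (X : {set V}) (l : V -> nat) (u : V) : nat :=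
  (\sum_(i < L) (u \in reach e X l i))%N.

Lemma sum_mem_levels (L : nat) (S : nat -> {set V}) :
  (\sum_u \sum_(i < L) (u \in S i) = \sum_(i < L) #|S i|)%N.
Proof.
rewrite exchange_big; apply: eq_bigr => i _.
by rewrite -sum1_card [RHS]big_mkcond; apply: eq_bigr => u _; case: (u \in _).
Qed.

(** With K and D the sums of |S_i| and |F_i|, K <= D/6 and M + 1 <= 2M bound the exponent by
    -D/(3M). One half of it yields the term in |F_0|, the other, by greediness, the sum of the
    labels. *)
Lemma exponent_bound (L M : nat) (X : {set V}) (l : V -> nat) :
  (0 < L)%N -> (0 < M)%N -> (forall u, (l u <= L)%N) ->
  (forall i, (i < L)%N ->
     (6 * #|core e d (reach e X l i)| <= #|reach e X l i|)%N) ->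
  (forall i, (i < L)%N -> (d * #|superlevel l i| <= 10 * #|reach e X l i|)%N) ->
  \sum_u ((height e d L X l u)%:R / M%:R - (depth L X l u)%:R / M.+1%:R)
    <= - (#|cnbhd e X|%:R / (6 * M%:R))
       - d%:R / (60 * M%:R) * (\sum_u l u)%:R :> R.
Proof.
move=> L0 M0 lL small greedy.
rewrite sumrB -!mulr_suml -!natr_sum.
have -> : (\sum_u height e d L X l u = \sum_(i < L) #|core e d (reach e X l i)|)%N.
  exact: (sum_mem_levels L (fun i => core e d (reach e X l i))).
have -> : (\sum_u depth L X l u = \sum_(i < L) #|reach e X l i|)%N.
  exact: (sum_mem_levels L (reach e X l)).
have -> : (\sum_u l u = \sum_(i < L) #|superlevel l i|)%N.
  rewrite -(sum_mem_levels L (superlevel l)); apply: eq_bigr => u _.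
  rewrite -[LHS](minn_idPl (lL u)) -sum_ord_lt.
  by apply: eq_bigr => i _; rewrite inE.
set K := (\sum_(i < L) #|core _ _ _|)%N; set D := (\sum_(i < L) #|reach _ _ _ _|)%N.
set S := (\sum_(i < L) _)%N; set b := #|cnbhd e X|.
have KD : 6 * K%:R <= D%:R :> R.
  by rewrite -natrM ler_nat big_distrr; apply: leq_sum => i _; exact: small.
have SD : d%:R * S%:R <= 10 * D%:R :> R.
  by rewrite -!natrM ler_nat !big_distrr; apply: leq_sum => i _; exact: greedy.
have bD : b%:R <= D%:R :> R.
  rewrite ler_nat /D (bigD1 (Ordinal L0)) //= (leq_trans _ (leq_addr _ _)) //.
  by apply/subset_leq_card/cnbhdS/subsetUl.
have M0r : 0 < M%:R :> R by rewrite ltr0n.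
have M1 : 1 <= M%:R :> R by rewrite ler1n.
have D0 : 0 <= D%:R :> R by exact: ler0n.
rewrite -natr1.
have DM : D%:R / (2 * M%:R) <= D%:R / (M%:R + 1) :> R.
  by rewrite ler_wpM2l // lef_pV2 ?posrE; lra.
have -> : - (b%:R / (6 * M%:R)) - d%:R / (60 * M%:R) * S%:R
    = - (10 * b%:R + d%:R * S%:R) / 60 / M%:R :> R.
  by field; rewrite gt_eqF.
apply: (@le_trans _ _ (- (20 * D%:R) / 60 / M%:R)); last first.
  by rewrite ler_wpM2r ?invr_ge0 ?(ltW M0r) //; lra.
apply: (@le_trans _ _ (K%:R / M%:R - D%:R / (2 * M%:R))); first by rewrite lerD2l lerN2.
have -> : K%:R / M%:R - D%:R / (2 * M%:R) = (K%:R - D%:R / 2) / M%:R :> R.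
  by field; rewrite gt_eqF.
by rewrite ler_wpM2r ?invr_ge0 ?(ltW M0r) //; lra.
Qed.

Variables (M : nat) (lambda : R) (k : int).
Hypothesis e_sym : symmetric e.
Hypothesis expd : expander e d lambda.
Hypothesis lambda_gt0 : 0 < lambda.
Hypothesis lambda_le : lambda <= d%:R / 5.
Hypothesis M_gt0 : (0 < M)%N.

Lemma reach_sub0 (X : {set V}) (l : V -> nat) (i : nat) :
  reach e X l i \subset reach e X l 0.
Proof.
apply: cnbhdS; apply/subsetP => u; rewrite !inE => /orP[|il]; last first.
  by rewrite (leq_ltn_trans _ il) ?orbT.
by case: (i == 0%N) => [->//|]; rewrite inE.
Qed.

Lemma count_label (L : nat) (X : {set V}) (l : V -> nat)
    (B A : seq {ffun V -> int}) :
  (0 < L)%N -> (forall u, (l u <= L)%N) ->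
  uniq B ->
  (forall f, f \in A <-> Lip_star e d lambda M k f) ->
  {subset B <= A} ->
  (forall f, f \in B ->
  [/\ forall i u, (i < L)%N -> u \in reach e X l i -> i%:Z < rel_height M k f u,
      forall u, u \in active e d X l (rel_height M k f) ->
        rel_height M k f u <= M%:Z + (height e d L X l u)%:Z,
      forall u w, u \in active e d X l (rel_height M k f) ->
        w \notin active e d X l (rel_height M k f) -> e u w ->
        rel_height M k f w <= M%:Z &
      forall i, (i < L)%N ->
        (d * #|superlevel l i| <= 10 * #|reach e X l i|)%N]) ->
  (size B)%:R <= expR (- (#|cnbhd e X|%:R / (6 * M%:R)))
     * \prod_u expR (- (d%:R / (60 * M%:R))) ^+ l u * (size A)%:R :> R.
Proof.
move=> L0 lL uB AP BA BP.
(* An element of [B] is needed to see that the sets F_i consist of outliers and are therefore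
   small. *)
have [->|[f0 f0B]] : B = [::] \/ exists f, f \in B.
- by case: (B) => [|f B']; [left | right; exists f; exact: mem_head].
- by rewrite !mulr_ge0 ?expR_ge0 ?prodr_ge0 // => u _; rewrite exprn_ge0 ?expR_ge0.
have [h0 _ _ greedy] := BP f0 f0B.
have /AP[_ outf0] := BA f0 f0B.
have small i : (i < L)%N ->
    (6 * #|core e d (reach e X l i)| <= #|reach e X l i|)%N.
  move=> _; rewrite -(ler_nat R) natrM.
  apply: core_small expd _ lambda_gt0 lambda_le _.
  apply: le_trans outf0; rewrite ler_nat.
  apply: subset_leq_card; apply: subset_trans (reach_sub0 _ _ _) _.
  apply/subsetP => u uF; have := h0 0%N u L0 uF.
  by rewrite inE /rel_height; lia.
apply: le_trans (count_by_window e_sym M_gt0 (F := reach e X l 0)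
  (S := core e d (reach e X l 0)) (lo := depth L X l)
  (up := height e d L X l) _ uB AP BA _ _ _) _.
- move=> u uF; apply: big1 => i _; apply/eqP; rewrite eqb0.
  by apply: contra uF; apply: (subsetP (reach_sub0 _ _ _)).
- move=> f u fB uF; have [hf _ _ _] := BP f fB.
  have h1 := hf 0%N u L0 uF; split; last by lia.
  have -> : rel_height M k f u = (absz (rel_height M k f u))%:Z by lia.
  rewrite lez_nat; set m := absz _.
  apply: (@leq_trans (minn m L)); last exact: geq_minl.
  rewrite -sum_ord_lt; apply: leq_sum => i _.
  by case: (boolP (u \in reach _ _ _ _)) => // /(hf i u (ltn_ord i)); lia.
- by move=> f u /BP[_ hf _ _]; exact: hf.
- by move=> f u w /BP[_ _ hf _]; exact: hf.
rewrite ler_wpM2r // prodrXr -expRM_natl -expRD ler_expR.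
apply: le_trans (exponent_bound L0 M_gt0 lL small greedy) _.
by rewrite lerD2l mulrN mulrC.
Qed.

End LabelWeight.

(** * Summation over labels and conclusion *)

Lemma size_partition (T : Type) (I : finType) (g : T -> I) (s : seq T) :
  (size s = \sum_i size [seq x <- s | g x == i])%N.
Proof.
elim: s => [|x s IH] /=; first by rewrite big1.
rewrite IH (bigD1 (g x)) //= [in RHS](bigD1 (g x)) //= eqxx /= addSn.
congr (_ + _).+1; apply: eq_bigr => i /negbTE; rewrite eq_sym => ->.
by [].
Qed.

Lemma tail_count (R : realType) (V : finType) (e : rel V) (d M : nat)
    (lambda : R) (k : int) (s : nat) (v : V) (A B : seq {ffun V -> int}) :
  symmetric e -> expander e d lambda -> 0 < lambda -> lambda <= d%:R / 5 ->
  (0 < M)%N -> uniq B ->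
  (forall f, f \in A <-> Lip_star e d lambda M k f) ->
  {subset B <= A} ->
  (forall f, f \in B -> (M + s * M)%:Z < rel_height M k f v) ->
  let q : R := expR (- (d%:R / (60 * M%:R))) in
  q <= 1 / 2 -> 4 * q * (d.+1 ^ 7)%:R <= 1 / (100 * M%:R) ->
  (size B)%:R <= expR (- (47 / 300 * (#|cnbhd e [set u | near e s v u]|%:R / M%:R)))
    * (size A)%:R :> R.
Proof.
move=> sym expd l0 ld M0 uB AP BA hB q q2 qD.
have [reg _] := expd.
set X := [set u | near e s v u].
have d0 : (0 < d)%N by rewrite -(ltr0n R); lra.
have M0r : 0 < M%:R :> R by rewrite ltr0n.
(* A common bound for all relative heights in the finite set [A], made positive by the successor. *)
pose L := (\sum_(f <- A) \sum_u absz (rel_height M k f u)).+1%N.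
have hL f u : f \in A -> rel_height M k f u <= L%:Z.
  move=> fA; have : (absz (rel_height M k f u) <= L)%N; last by lia.
  by rewrite /L (big_rem f) //= (bigD1 u) //= -!addnA leqW // leq_addr.
have Lip f : f \in A ->
    forall u w, e u w -> `|rel_height M k f u - rel_height M k f w| <= M%:Z.
  move=> /AP[Lf _] u w /Lf; rewrite /rel_height.
  by rewrite (_ : f u - k - M%:Z - (f w - k - M%:Z) = f u - f w) //; ring.
have levels f : exists l : {ffun V -> 'I_L.+1}, f \in B ->
  [/\ forall i u, (i < L)%N -> u \in reach e X (label l) i -> i%:Z < rel_height M k f u,
      forall u, u \in active e d X (label l) (rel_height M k f) ->
        rel_height M k f u <= M%:Z + (height e d L X (label l) u)%:Z,
      forall u w, u \in active e d X (label l) (rel_height M k f) ->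
        w \notin active e d X (label l) (rel_height M k f) -> e u w ->
        rel_height M k f w <= M%:Z,
      attached (near e 7) X [set u | l u != ord0] &
      forall i, (i < L)%N ->
        (d * #|superlevel (label l) i| <= 10 * #|reach e X (label l) i|)%N].
  have [fB|] := boolP (f \in B); last by exists [ffun=> ord0].
  have fA := BA f fB.
  have [||u|l lP] := @level_structure V e d sym reg (rel_height M k f) M L s v d0.
  - exact: Lip.
  - by move=> u; have := hL f u fA; lia.
  - move=> uX; have := near_Lipschitz (Lip f fA) (m := s) (x := v) (y := u).
    move: uX; rewrite inE => vu /(_ vu).
    by have := hB f fB; rewrite ler_norml; lia.
  by exists l.
have [lab labP] := choice levels.
pose w (l : {ffun V -> 'I_L.+1}) : R := \prod_u q ^+ l u.
have w0 l : 0 <= w l by rewrite prodr_ge0 // => u _; rewrite exprn_ge0 ?expR_ge0.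
set b := #|cnbhd e X|.
have one l : (size [seq f <- B | lab f == l])%:R
    <= (if attached (near e 7) X [set u | l u != ord0] then w l else 0)
       * (expR (- (b%:R / (6 * M%:R))) * (size A)%:R) :> R.
  have memB f : f \in [seq f <- B | lab f == l] -> lab f = l /\ f \in B.
    by rewrite mem_filter => /andP[/eqP].
  have [Bl0|[f0 /memB[lf0 f0B]]] :
      [seq f <- B | lab f == l] = [::] \/ exists f, f \in [seq f <- B | lab f == l].
  - by case: [seq f <- B | _] => [|f B']; [left | right; exists f; exact: mem_head].
  - by rewrite Bl0 mulr_ge0 ?mulr_ge0 ?expR_ge0 //; case: ifP.
  have [_ _ _ att _] := labP f0 f0B; rewrite lf0 in att; rewrite att.
  rewrite mulrA [w l * _]mulrC.
  apply: (count_label sym expd l0 ld M0 (L := L) (X := X) (l := label l) _ _ _ AP) => //.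
  - by move=> u; rewrite -ltnS; exact: ltn_ord.
  - exact: filter_uniq.
  - by move=> f /memB[_ /BA].
  - by move=> f /memB[<- /labP[]].
rewrite (size_partition lab) natr_sum.
apply: le_trans (ler_sum _ (fun l _ => one l)) _.
rewrite -mulr_suml -big_mkcond /= [X in X <= _]mulrA ler_wpM2r //.
have q0 : 0 <= q by exact: expR_ge0.
have q40 : 0 <= 4 * q by rewrite mulr_ge0.
apply: (@le_trans _ _ (expR (4 * q * (#|X| * d.+1 ^ 7)%:R) * expR (- (b%:R / (6 * M%:R))))).
  rewrite ler_wpM2r ?expR_ge0 //.
  apply: le_trans (power_le_expR _ q40).
  apply: sum_attached_labels => // [x|]; first exact: card_near.
  apply: le_trans (power_le_expR _ q40) _; apply: le_trans (expR_hundredth R).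
  rewrite ler_expR; apply: le_trans qD _.
  by rewrite ler_wpM2l // lef_pV2 ?posrE ?mulr_gt0 // ler_peMr // ler1n.
rewrite -expRD ler_expR.
have Xb : #|X|%:R <= b%:R :> R by rewrite ler_nat; apply/subset_leq_card/sub_cnbhd.
(* Summing over labels costs at most b/(100M), which leaves 1/6 - 1/100 = 47/300 in the exponent. *)
have : 4 * q * (#|X| * d.+1 ^ 7)%:R <= 1 / (100 * M%:R) * b%:R.
  rewrite natrM mulrCA mulrC; apply: ler_pM => //.
  by rewrite mulr_ge0.
have -> : 1 / (100 * M%:R) * b%:R = 1 / 100 * (b%:R / M%:R) :> R.
  by field; rewrite gt_eqF.
have -> : b%:R / (6 * M%:R) = 1 / 6 * (b%:R / M%:R) :> R.
  by field; rewrite gt_eqF.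
lra.
Qed.

Theorem theorem1p3 (R : realType) :
  exists c C : R, 0 < c /\ 0 < C /\
  forall (M : nat) (V : finType) (e : rel V) (d : nat) (lambda : R),
    (1 <= M)%N ->
    simple_graph e ->
    connected_graph e ->
    (2 <= d)%N ->
    0 < lambda ->
    expander e d lambda ->
    lambda <= d%:R / 5 ->
    d%:R / 5 <= c * #|V|%:R ->
    M%:R <= Num.min (c * (d%:R `^ (3 / 2) / (lambda * log2 d%:R)))
                    (log2 #|V|%:R `^ C) ->
    forall (k : int) (t : nat) (v : V),
      (2 <= t)%N ->
      uniform_prob R (Lip_star e d lambda M k)
          [set f : {ffun V -> int} | k + (t * M)%:Z + 1 < f v]%classic
        <= 2 `^ (- (#|gball e v (t - 1)|%:R / (5 * M%:R))).
Proof.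
(* [degree_bound] doubles 1/3600, giving the 1/1800 required in [weight_bound]. *)
exists (1 / 3600), 1; split; first by lra.
split=> //.
move=> M V e d lambda M0 [sym _] conn d2 l0 expd ld dn Mle k t v t2.
have M0r : 0 < M%:R :> R by rewrite ltr0n.
have n0 : (0 < #|V|)%N by apply/card_gt0P; exists v.
have d0 : (0 < d)%N by exact: ltn_trans d2.
have finA := finite_Lip_star M k conn n0 d0 ld.
have sl : Num.sqrt d%:R <= 2 * lambda.
  by apply: (expander_sqrt_le expd v dn); lra.
have Md : M%:R * ln d%:R <= 2 * (1 / 3600) * d%:R :> R.
  apply: (degree_bound d2 l0 _ sl); first by lra.
  by move: Mle; rewrite le_min => /andP[].
have [q2 qD] := weight_bound d2 M0 Md.
set E := [set f : {ffun V -> int} | _]%classic.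
set A := Lip_star e d lambda M k in finA *.
have finB : finite_set (A `&` E)%classic by apply: finite_setIl.
have memA f : f \in enum_fset (fset_set A) <-> A f.
  by rewrite -[_ \in _]/(f \in fset_set A) in_fset_set //; split=> [/set_mem|/mem_set].
have memB f : f \in enum_fset (fset_set (A `&` E)%classic) -> A f /\ E f.
  by rewrite -[_ \in _]/(f \in fset_set (A `&` E)%classic) in_fset_set // => /set_mem.
have hB f : f \in enum_fset (fset_set (A `&` E)%classic) ->
    (M + (t - 2) * M)%:Z < rel_height M k f v.
  move=> /memB[_]; rewrite /E /= /rel_height.
  have -> : (t * M = (t - 2) * M + 2 * M)%N by rewrite -mulnDl subnK.
  by move: (f v) ((t - 2) * M)%N => x y; clear; lia.
have := @tail_count R V e d M lambda k (t - 2) v _ _ sym expd l0 ld M0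
  (fset_uniq _) memA (fun f fB => (memA f).2 (memB f fB).1) hB q2 qD.
move=> tail; rewrite /uniform_prob.
have [A0|A0] := eqVneq (#|` fset_set A|%:R : R) 0.
  by rewrite A0 invr0 mulr0 powR_ge0.
rewrite ler_pdivrMr; last by rewrite lt_neqAle eq_sym A0 ler0n.
apply: le_trans tail _; rewrite ler_wpM2r //.
rewrite /powR pnatr_eq0 /= ler_expR mulNr lerN2.
(* The radius [t - 2] of X is chosen so that its closed neighbourhood contains the ball of radius
   [t - 1]. *)
have ball : #|gball e v (t - 1)|%:R
    <= #|cnbhd e [set u | near e (t - 2) v u]|%:R :> R.
  rewrite ler_nat; apply/subset_leq_card/subsetP => u /(gball_near sym conn).
  have -> : (t - 1 = (t - 2).+1)%N by move: t2; clear; lia.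
  by move=> /nearSP[w vw wu]; apply/cnbhdP; exists w; rewrite // inE.
set g := #|gball _ _ _|%:R in ball *; set b := #|cnbhd _ _|%:R in ball *.
have -> : g / (5 * M%:R) * ln 2 = ln 2 / 5 * (g / M%:R).
  by field; rewrite gt_eqF.
apply: ler_pM; rewrite ?divr_ge0 ?ler0n ?(ltW (ln2_gt0 R)) //.
  by have := ln2_lt R; lra.
by rewrite ler_wpM2r // invr_ge0 ltW.
Qed.
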